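(* (1) $N_k(1)=2$ for $k=2,3,5,9,14$. (2) For all integers $k\ge 1$ and $m\ge 2$, $$N_k(m)\le\left\lceil\frac{R_{\frac{k+1}{k}}(m)}{k+1}\right\rceil.$$ (3) For all integers $k\ge 1$ and $m\ge 2$, if $R_{\frac{k+1}{k}}(m)\equiv 1\pmod{k+1}$, then $$N_k(m)=\left\lceil\frac{R_{\frac{k+1}{k}}(m)}{k+1}\right\rceil=\frac{R_{\frac{k+1}{k}}(m)+k}{k+1}.$$ (4) For all integers $k\ge 1$ and $m\ge 2$, if $R_{\frac{k+1}{k}}(m)\equiv 2\pmod{k+1}$, then $$N_k(m)=\left\lceil\frac{R_{\frac{k+1}{k}}(m)}{k+1}\right\rceil=\frac{R_{\frac{k+1}{k}}(m)+k-1}{k+1}.$$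
   Context: $\pi(x)$ denotes the number of primes $p\le x$. For a real number $v>1$ and a positive integer $m$, the $v$-Ramanujan number $R_v(m)$ is the smallest positive integer such that for all integers $x\ge R_v(m)$ one has $\pi(x)-\pi(x/v)\ge m$. For positive integers $k,m$, $N_k(m)$ is the smallest positive integer such that for every integer $n\ge N_k(m)$ the open interval $(kn,(k+1)n)$ contains at least $m$ primes. *)

(* Defs.v *)
From mathcomp Require Import all_boot all_order all_algebra.
From mathcomp Require Import reals.
Set Implicit Arguments.
Unset Strict Implicit.
Unset Printing Implicit Defensive.
Import Order.TTheory GRing.Theory Num.Theory.
Local Open Scope ring_scope.

Definition smallest_pos (P : nat -> Prop) (r : nat) : Prop :=
  [/\ (0 < r)%N, P r & forall s : nat, (0 < s)%N -> P s -> (r <= s)%N].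

Lemma smallest_pos_uniq (P : nat -> Prop) (r s : nat) :
  smallest_pos P r -> smallest_pos P s -> r = s.
Proof.
move=> [r0 Pr minr] [s0 Ps mins].
by apply/eqP; rewrite eqn_leq minr // mins.
Qed.

Definition primepi (R : realType) (x : R) : nat :=
  count prime (index_iota 0 (Num.truncn x).+1).

Lemma primepi_nat (R : realType) (n : nat) :
  primepi (n%:R : R) = count prime (index_iota 0 n.+1).
Proof. by rewrite /primepi natrK. Qed.

Lemma mem_primepi_range (R : realType) (x : R) (p : nat) : 0 <= x ->
  (p \in index_iota 0 (Num.truncn x).+1) = (p%:R <= x).
Proof. by move=> x0; rewrite mem_index_iota /= ltnS truncn_ge_nat. Qed.

(* [ramanujan v m r] means r = R_v(m). The definite description is rendered as
   a functional relation (see [smallest_pos_uniq]), since the existence of the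
   least element is a separate number-theoretic fact. The truncated subtraction
   is exact for v > 1 because primepi is nondecreasing. *)
Definition ramanujan (R : realType) (v : R) (m r : nat) : Prop :=
  smallest_pos (fun r => forall x : nat, (r <= x)%N ->
    (m <= primepi (x%:R : R) - primepi (x%:R / v))%N) r.

(* [prime_threshold k m N] means N = N_k(m); the range of the count is the set
   of integers strictly between kn and (k+1)n. *)
Definition prime_threshold (k m N : nat) : Prop :=
  smallest_pos (fun N => forall n : nat, (N <= n)%N ->
    (m <= count prime (index_iota (k * n).+1 (k.+1 * n)))%N) N.

(* Main.v *)
(** With lg the logarithm to base 2, Legendre's formula says that lg m! is the sum over
prime powers q = p^k of lg p * (m %/ q), and psi (m %/ j) is the sum of lg p over the q
with j <= m %/ q. A pointwise inequality between step functions of t = m %/ q, of the form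
  Q <= sum_d a_d d (t %/ d) + sum_j b_j [j <= t]   with   sum_d a_d = 0,
therefore gives, with Stirling's formula,
  Q psi(n) <= - n sum_d a_d lg d + sum_j b_j psi(n %/ j) + O(log n)
(Chebyshev's method), and replacing Q by -Q gives a lower bound. Starting from
psi(n) <= 2.02 n + O(1), two rounds of such inequalities confine psi(n) / n, up to a
bounded error term, to an interval whose endpoints have ratio less than 15/14. Hence there
are primes between 14 n and 15 n for n >= 4000000; smaller n are covered by a chain of
primes with ratios at most 15/14. The intervals (k n, (k+1) n) with k <= 9 contain an
interval [14 n', 15 n'] as soon as n >= 39.

For v = (k+1)/k one has x / v = k n + k e / (k+1) at x = (k+1) n + e, so
pi(x) - pi(x/v) counts the primes in (k n, (k+1) n + e] for e <= 1. Since (k+1) n is not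
prime for n > 1, the numbers R_v(m) and N_k(m) can be compared at these x. *)
From Stdlib Require Import ZArith.
Require Import Defs.
From mathcomp Require Import all_boot all_order all_algebra.
From mathcomp Require Import boolp reals exp.
From mathcomp Require Import zify ssrZ ring lra.
Set Implicit Arguments.
Unset Strict Implicit.
Unset Printing Implicit Defensive.
Import Order.TTheory GRing.Theory Num.Theory.
Local Open Scope ring_scope.

(** * Stirling's formula *)

Section Log.
Variable R : realType.
Implicit Types x y : R.

(** The tangent inequality ln u <= u - 1 at u = y / x, multiplied by x so that later uses stay free
    of divisions. *)
Lemma mulr_ln_sub x y : 0 < x -> 0 < y -> x * (ln y - ln x) <= y - x.
Proof.
move=> x0 y0; rewrite -ln_div ?posrE//.
have y1 : ln (y / x) <= y / x - 1.
  have := @le_ln1Dx R (y / x - 1); rewrite addrCA subrr addr0; apply.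
  by rewrite ltrBrDr addNr divr_gt0.
by rewrite (le_trans (ler_wpM2l (ltW x0) y1))// mulrBr mulr1 mulrCA mulfV ?gt_eqF// mulr1.
Qed.

Lemma ln2_ge : 2^-1 <= ln 2 :> R.
Proof. have := @mulr_ln_sub 2 1 ltac:(lra) ltac:(lra); rewrite ln1; lra. Qed.

Lemma ln2_le : ln 2 <= 1 :> R.
Proof. have := @mulr_ln_sub 1 2 ltac:(lra) ltac:(lra); rewrite ln1; lra. Qed.

(** In the induction step, with b = a - 1, the two orders of [mulr_ln_sub] give b (ln a - ln b) <= 1
    <= a (ln a - ln b), which is what the lower and the upper bound need. *)
Lemma ln_fact_bounds (n : nat) : (0 < n)%N ->
  n%:R * ln n%:R - n%:R + 1 <= ln (n`!%:R : R)
    <= n%:R * ln n%:R - n%:R + 1 + ln n%:R.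
Proof.
elim: n => // -[_ _|n IHn _]; first by rewrite ln1; lra.
have n0 : 0 < n.+1%:R :> R by rewrite ltr0n.
have n1 : 0 < n.+2%:R :> R by rewrite ltr0n.
have /andP[lo hi] := IHn isT.
rewrite factS natrM lnM ?posrE ?ltr0n ?fact_gt0//.
have := mulr_ln_sub n0 n1; have := mulr_ln_sub n1 n0.
have : n.+2%:R = n.+1%:R + 1 :> R by rewrite -natr1.
move: (n.+2%:R) (n.+1%:R) (ln _) (ln _) lo hi => a b c d + + ->.
by move=> lo hi H1 H2; apply/andP; split; nra.
Qed.

(** Stirling's formula in a form suited to cancellation: in a combination with sum_d a_d = 0 the
    parts n ln n and n drop out and -n sum_d a_d ln d remains. *)
Lemma ln_fact_divn (n d : nat) : (0 < n)%N -> (0 < d)%N ->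
  `|d%:R * ln (n %/ d)`!%:R - (n%:R * (ln n%:R - ln d%:R) - n%:R)|
    <= d%:R * (1 + ln n%:R : R).
Proof.
move=> n0 d0; have nR : 0 < n%:R :> R by rewrite ltr0n.
have dR : 0 < d%:R :> R by rewrite ltr0n.
have d1 : 1 <= d%:R :> R by rewrite ler1n.
have lnn : 0 <= ln n%:R :> R by rewrite ln_ge0 ?ler1n.
have lnd : 0 <= ln d%:R :> R by rewrite ln_ge0 ?ler1n.
have := ltn_pmod n d0; have := divn_eq n d.
move: (n %/ d)%N (n %% d)%N => m r nE rd.
have rR : r%:R <= d%:R :> R by rewrite ler_nat ltnW.
have r0 : 0 <= r%:R :> R by [].
have [m0|m0] := posnP m.
  have nr : n%:R = r%:R :> R by rewrite nE m0.
  rewrite m0 fact0 ln1 mulr0 ler_norml; have := mulr_ln_sub nR dR.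
  by rewrite nr in lnn nR * => H; apply/andP; split; nra.
have mR : 0 < m%:R :> R by rewrite ltr0n.
have nR' : n%:R = m%:R * d%:R + r%:R :> R by rewrite nE natrD natrM.
have mdR : 0 < m%:R * d%:R :> R by rewrite mulr_gt0.
have H1 := mulr_ln_sub mdR nR; have H2 := mulr_ln_sub nR mdR.
have /andP[lo hi] := ln_fact_bounds m0.
have lnm : ln m%:R <= ln n%:R - ln d%:R :> R.
  rewrite lerBrDr -lnM ?posrE// ler_ln ?posrE// nR'; lra.
rewrite lnM ?posrE// in H1 H2.
move: (ln m%:R) (ln m`!%:R) lnm lo hi H1 H2 => x T lnm lo hi H1 H2.
move: (ln n%:R) (ln d%:R) lnn lnd lnm H1 H2 => y z lnn lnd lnm.
rewrite nR' ler_norml => H1 H2.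
by apply/andP; split; nra.
Qed.

End Log.

(** * Logarithms to base 2 *)

Section Lg.
Variable R : realType.
Implicit Types x y : R.

(* Base 2 makes the logarithms computable from the bits of repeated squares. *)
Definition lg x := ln x / ln 2.

Lemma ln2_gt0 : 0 < ln 2 :> R.
Proof. by rewrite (lt_le_trans _ (ln2_ge R))// invr_gt0. Qed.

Lemma lg1 : lg 1 = 0.
Proof. by rewrite /lg ln1 mul0r. Qed.

Lemma lg2 : lg 2 = 1.
Proof. by rewrite /lg divff// gt_eqF// ln2_gt0. Qed.

Lemma lgM x y : 0 < x -> 0 < y -> lg (x * y) = lg x + lg y.
Proof. by move=> x0 y0; rewrite /lg lnM ?posrE// mulrDl. Qed.

Lemma lgX x n : 0 < x -> lg (x ^+ n) = n%:R * lg x.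
Proof. by move=> x0; rewrite /lg lnXn// mulrA mulr_natl. Qed.

Lemma ler_lg x y : 0 < x -> x <= y -> lg x <= lg y.
Proof.
move=> x0 xy; rewrite /lg ler_pM2r ?invr_gt0 ?ln2_gt0// ler_ln ?posrE//.
exact: lt_le_trans xy.
Qed.

Lemma lg_ge0 (n : nat) : 0 <= lg n%:R.
Proof.
case: n => [|n]; first by rewrite /lg ln0// mul0r.
by rewrite divr_ge0 ?ln_ge0 ?ler1n// ltW// ln2_gt0.
Qed.

(** Reduces to lg y <= y for y = x / 2^k. It absorbs logarithms into linear bounds; a larger k buys
    a smaller slope at the price of a larger constant. *)
Lemma lg_le x k : 0 < x -> lg x <= k%:R + x / 2 ^+ k.
Proof.
move=> x0; have k0 : 0 < 2 ^+ k :> R by rewrite exprn_gt0.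
have y0 : 0 < x / 2 ^+ k by rewrite divr_gt0.
rewrite -{1}(divfK (lt0r_neq0 k0) x) lgM// lgX// lg2 mulr1 addrC lerD2l.
rewrite /lg ler_pdivrMr ?ln2_gt0//.
(* The tangent of ln at 2 gives ln y <= y / 2 + ln 2 - 1 <= y ln 2. *)
have := @mulr_ln_sub R 2 _ ltac:(lra) y0; have := ln2_ge R; have := ln2_le R.
nra.
Qed.

Lemma lg_fact_divn (n d : nat) : (0 < n)%N -> (0 < d)%N ->
  `|d%:R * lg (n %/ d)`!%:R - (n%:R * (lg n%:R - lg d%:R) - n%:R / ln 2)|
    <= d%:R * (2 + lg n%:R).
Proof.
move=> n0 d0; have := ln_fact_divn R n0 d0; have l0 := ln2_gt0.
rewrite -(ler_pM2r (_ : 0 < (ln 2)^-1)) ?invr_gt0//.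
rewrite -{1}(gtr0_norm (_ : 0 < (ln 2)^-1)) ?invr_gt0// -normrM.
have -> : (d%:R * ln (n %/ d)`!%:R - (n%:R * (ln n%:R - ln d%:R) - n%:R)) / ln 2 =
  d%:R * lg (n %/ d)`!%:R - (n%:R * (lg n%:R - lg d%:R) - n%:R / ln 2) :> R.
  by rewrite /lg; ring.
move=> /le_trans; apply; rewrite -mulrA ler_wpM2l ?ler0n// mulrDl lerD2r mul1r.
by rewrite invf_ple ?posrE// ln2_ge.
Qed.
End Lg.

(** * Sums over prime powers *)

Section Lam.
Variable R : realType.
Implicit Types (w : nat -> R) (n B : nat).

(** The sum of Lambda(q) w(n %/ q) over prime powers q, with von Mangoldt's function to base 2. The
    range bound B is kept apart from n so that sums for different n can be brought to a common
    range; if w 0 = 0, every B >= n gives the same value. *)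
Definition primepow_sum B n w : R :=
  \sum_(0 <= p < B.+1 | prime p) \sum_(1 <= k < B.+1)
    lg p%:R * w (n %/ p ^ k)%N.

Lemma primepow_sum_widen B n w : (n <= B)%N -> w 0%N = 0 ->
  primepow_sum B n w = primepow_sum n n w.
Proof.
move=> nB w0; rewrite /primepow_sum (big_cat_nat (n := n.+1))//= [X in _ + X]big1_seq ?addr0.
  apply: eq_bigr => p pp; rewrite (big_cat_nat (n := n.+1))//= [X in _ + X]big1_seq ?addr0//.
  move=> k /andP[_]; rewrite mem_index_iota => /andP[nk _].
  by rewrite divn_small ?w0 ?mulr0// (leq_trans nk)// ltnW// ltn_expl// prime_gt1.
move=> p /andP[pp]; rewrite mem_index_iota => /andP[np _].
rewrite big1_seq// => k /andP[_]; rewrite mem_index_iota => /andP[k0 _].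
rewrite divn_small ?w0 ?mulr0// (leq_trans np)//.
by rewrite -{1}(expn1 p) leq_exp2l// prime_gt1.
Qed.

Lemma primepow_sum_ge0 B n w :
  (forall t, 0 <= w t) -> 0 <= primepow_sum B n w.
Proof.
move=> w0; apply: sumr_ge0 => p _; apply: sumr_ge0 => k _.
by rewrite mulr_ge0 ?lg_ge0.
Qed.

Lemma primepow_sumD B n w w' :
  primepow_sum B n (fun t => w t + w' t) = primepow_sum B n w + primepow_sum B n w'.
Proof.
rewrite /primepow_sum -big_split/=; apply: eq_bigr => p _.
by rewrite -big_split/=; apply: eq_bigr => k _; rewrite mulrDr.
Qed.

Lemma primepow_sumZ B n c w :
  primepow_sum B n (fun t => c * w t) = c * primepow_sum B n w.
Proof.
rewrite /primepow_sum mulr_sumr; apply: eq_bigr => p _.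
by rewrite mulr_sumr; apply: eq_bigr => k _; rewrite mulrCA.
Qed.

Lemma primepow_sum_sum B n I (s : seq I) (F : I -> nat -> R) :
  primepow_sum B n (fun t => \sum_(i <- s) F i t) = \sum_(i <- s) primepow_sum B n (F i).
Proof.
elim: s => [|i s IHs].
  rewrite big_nil /primepow_sum big1// => p _; rewrite big1// => k _.
  by rewrite big_nil mulr0.
rewrite big_cons -IHs -primepow_sumD /primepow_sum.
by apply: eq_bigr => p _; apply: eq_bigr => k _; rewrite big_cons.
Qed.

(** Since (n %/ d) %/ q = (n %/ q) %/ d, a sum at n %/ d becomes a sum at n with another weight, so
    that all terms of Chebyshev's method can be compared pointwise. *)
Lemma primepow_sum_divn n d w : (0 < d)%N -> w 0%N = 0 ->
  primepow_sum (n %/ d) (n %/ d) w = primepow_sum n n (fun t => w (t %/ d)%N).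
Proof.
move=> d0 w0; rewrite -(@primepow_sum_widen n) ?leq_div//.
by apply: eq_bigr => p _; apply: eq_bigr => k _; rewrite -!divnMA mulnC.
Qed.

Lemma lg_prod (s : seq nat) (P : pred nat) (F : nat -> nat) :
  (forall i, P i -> (0 < F i)%N) ->
  lg (\prod_(i <- s | P i) F i)%N%:R = \sum_(i <- s | P i) lg (F i)%:R :> R.
Proof.
move=> F0; elim: s => [|i s IHs]; first by rewrite !big_nil lg1.
rewrite !big_cons; case: ifP => // Pi.
by rewrite natrM lgM ?ltr0n ?IHs ?F0// prodn_cond_gt0.
Qed.

Lemma lg_fact n : lg n`!%:R = primepow_sum n n (fun t => t%:R).
Proof.
(* The factorization supplied by [partnT] ranges over all p <= n!, so the sum is widened to that
   bound first. *)
have -> : primepow_sum n n (fun t => t%:R) = primepow_sum n`! n (fun t => t%:R).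
  by rewrite [RHS]primepow_sum_widen// fact_geq.
have fE := partnT (fact_gt0 n); rewrite /partn in fE.
move: (n`!) (fact_geq n) (fun p => @logn_fact p n) fE => f nf lognf fE.
rewrite -[in LHS]fE lg_prod; last first.
  by move=> [|p] _; rewrite expn_gt0// lognE.
rewrite big_mkcond [RHS]big_mkcond; apply: eq_bigr => p _ /=.
case: ifP => [pp|pp]; last by rewrite lognE pp lg1.
rewrite natrX lgX ?ltr0n ?prime_gt0// lognf// natr_sum mulr_suml.
under [RHS]eq_bigr do rewrite mulrC.
rewrite [RHS](big_cat_nat (n := n.+1))//= [X in _ = _ + X]big1_seq ?addr0//.
move=> k /andP[_]; rewrite mem_index_iota => /andP[nk _].
by rewrite divn_small ?mul0r// (leq_trans nk)// ltnW// ltn_expl// prime_gt1.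
Qed.

(** Chebyshev's function to base 2: the weight selects the prime powers q <= n. *)
Definition psi n : R := primepow_sum n n (fun t => (0 < t)%N%:R).

Lemma psi0 : psi 0 = 0.
Proof. by rewrite /psi /primepow_sum big1// => p _; rewrite big_geq. Qed.

Lemma psi_ge0 n : 0 <= psi n.
Proof. exact: primepow_sum_ge0. Qed.

Lemma psi_divn n d : (0 < d)%N -> psi (n %/ d) = primepow_sum n n (fun t => (d <= t)%N%:R).
Proof.
move=> d0; rewrite /psi primepow_sum_divn//.
by apply: eq_bigr => p _; apply: eq_bigr => k _; rewrite divn_gt0.
Qed.

End Lam.

(** * Logarithms by computation *)

Section Cast.
Variable R : realType.

Definition zR (z : Z) : R := (int_of_Z z)%:~R.

Lemma zRD x y : zR (Z.add x y) = zR x + zR y.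
Proof. by rewrite /zR (raddfD int_of_Z) intrD. Qed.

Lemma zRN x : zR (Z.opp x) = - zR x.
Proof. by rewrite /zR (raddfN int_of_Z) mulrNz. Qed.

Lemma zRB x y : zR (Z.sub x y) = zR x - zR y.
Proof. by rewrite -zRN -zRD Z.add_opp_r. Qed.

Lemma zRM x y : zR (Z.mul x y) = zR x * zR y.
Proof. by rewrite /zR (rmorphM int_of_Z) intrM. Qed.

Lemma zR_nat n : zR (Z.of_nat n) = n%:R.
Proof. by rewrite /zR [RHS]pmulrn; congr (_ *~ _); lia. Qed.

Lemma zR_le x y : Z.le x y -> zR x <= zR y.
Proof. by move=> xy; rewrite /zR ler_int; lia. Qed.

Lemma zR_leb x y : Z.leb x y -> zR x <= zR y.
Proof. by move=> xy; apply: zR_le; lia. Qed.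

Lemma zR_pow2 n : zR (Z.pow 2 (Z.of_nat n)) = 2 ^+ n.
Proof.
elim: n => [|n IHn]; first by rewrite /zR.
by rewrite Nat2Z.inj_succ Z.pow_succ_r ?zRM ?IHn ?exprS//; lia.
Qed.

Lemma zR_div_le x y : Z.lt 0 y -> zR (Z.div x y) <= zR x / zR y.
Proof.
move=> y0; have yR : 0 < zR y by rewrite /zR ltr0z; lia.
rewrite ler_pdivlMr// -zRM; apply: zR_le.
by rewrite Z.mul_comm; apply: Z.mul_div_le.
Qed.

Lemma zR_div_ge x y : Z.lt 0 y -> zR x / zR y <= zR (Z.add (Z.div x y) 1).
Proof.
move=> y0; have yR : 0 < zR y by rewrite /zR ltr0z; lia.
rewrite ler_pdivrMr// -zRM; apply: zR_le.
have := Z.mul_succ_div_gt x y y0; lia.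
Qed.
End Cast.

(* Approximates 2^k lg (m / 2^P) by repeated squaring in fixed point arithmetic with P
   fractional bits, from below if r = 0 and from above if r = 1. *)
Fixpoint log2_approx (r : Z) (P k : nat) (m : Z) : Z :=
  let e := Z.sub (Z.log2 m) (Z.of_nat P) in
  match k with
  | 0%N => Z.add e r
  | S k' => let m1 := Z.add (Z.shiftr m e) r in
      Z.add (Z.mul e (Z.pow 2 (Z.of_nat k)))
        (log2_approx r P k' (Z.add (Z.shiftr (Z.mul m1 m1) (Z.of_nat P)) r))
  end.

Section LogApprox.
Variable R : realType.
Local Notation zR := (zR R).

Lemma shiftr_bounds (m : Z) (n : nat) :
  zR (Z.shiftr m (Z.of_nat n)) <= zR m / 2 ^+ n <= zR (Z.add (Z.shiftr m (Z.of_nat n)) 1).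
Proof.
rewrite Z.shiftr_div_pow2; last lia.
have p0 : Z.lt 0 (Z.pow 2 (Z.of_nat n)) by lia.
by rewrite -zR_pow2 zR_div_le// zR_div_ge.
Qed.

Lemma shiftr_ge (m : Z) (P : nat) (e : nat) : Z.le (Z.pow 2 (Z.of_nat (P + e))) m ->
  Z.le (Z.pow 2 (Z.of_nat P)) (Z.shiftr m (Z.of_nat e)).
Proof.
move=> H; rewrite Z.shiftr_div_pow2; last lia.
have p0 : Z.lt 0 (Z.pow 2 (Z.of_nat e)) by lia.
apply: Z.div_le_lower_bound => //; rewrite Z.mul_comm -Z.pow_add_r; lia.
Qed.

Lemma zR_gt0 (z : Z) (n : nat) : Z.le (Z.pow 2 (Z.of_nat n)) z -> 0 < zR z.
Proof. by move=> H; rewrite (lt_le_trans _ (zR_le R H))// zR_pow2 exprn_gt0. Qed.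

(** Without rounding, m / 2^P = 2^e u with u = m1 / 2^P, and u^2 = m2 / 2^P, so doubling the
    logarithm of u amounts to squaring it. Rounding both m1 and m2 in the same direction gives a
    one-sided bound. *)
Lemma log2_approx_step (P k : nat) (m m1 m2 : Z) (e : nat) :
  0 < zR m -> 0 < zR m1 -> 0 < zR m2 ->
  (zR m1 <= zR m / 2 ^+ e -> zR m2 <= zR m1 ^+ 2 / 2 ^+ P ->
   e%:R * 2 ^+ k.+1 + 2 ^+ k * lg (zR m2 / 2 ^+ P) <= 2 ^+ k.+1 * lg (zR m / 2 ^+ P)) /\
  (zR m / 2 ^+ e <= zR m1 -> zR m1 ^+ 2 / 2 ^+ P <= zR m2 ->
   2 ^+ k.+1 * lg (zR m / 2 ^+ P) <= e%:R * 2 ^+ k.+1 + 2 ^+ k * lg (zR m2 / 2 ^+ P)).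
Proof.
move=> m0 m10 m20.
have p2 n : 0 < 2 ^+ n :> R by rewrite exprn_gt0.
have lgV n : lg (2 ^+ n : R)^-1 = - n%:R.
  have := @lgM R (2 ^+ n) (2 ^+ n)^-1; rewrite divff ?gt_eqF// lg1 lgX// lg2 mulr1.
  by rewrite invr_gt0 p2 => /(_ isT isT); lra.
have lgdiv x n : 0 < x -> lg (x / 2 ^+ n : R) = lg x - n%:R.
  by move=> x0; rewrite lgM ?invr_gt0// lgV.
rewrite !lgdiv//; set K := 2 ^+ k.
have -> : 2 ^+ k.+1 = 2 * K by rewrite exprS.
have K0 : 0 < K by exact: p2.
split=> H1 H2.
- have := ler_lg m10 H1; have := ler_lg m20 H2.
  rewrite !lgdiv ?exprn_gt0// lgX//.
  move: (lg (zR m)) (lg (zR m1)) (lg (zR m2)) => x y z h1 h2.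
  rewrite -subr_ge0 (_ : _ - _ = K * (2 * (x - e%:R - y) + (2%:R * y - P%:R - z)))//; last by ring.
  by apply: mulr_ge0; [exact: ltW|lra].
- have := ler_lg _ H1; have := ler_lg _ H2.
  rewrite !lgdiv ?exprn_gt0// lgX// !divr_gt0 ?exprn_gt0// => /(_ isT) + /(_ isT).
  move: (lg (zR m)) (lg (zR m1)) (lg (zR m2)) => x y z h1 h2.
  rewrite -subr_ge0.
  rewrite (_ : _ - _ = K * (2 * (y - (x - e%:R)) + (z - (2%:R * y - P%:R)))); last by ring.
  by apply: mulr_ge0; [exact: ltW|lra].
Qed.

End LogApprox.

Section LogBounds.
Variable R : realType.
Local Notation zR := (zR R).

(** The hypothesis says that the represented number is at least 1. This persists for the rounded
    mantissas and squares, so every exponent e is a natural number; at the end of the recursion the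
    bounds are e and e + 1. *)
Lemma log2_approx_bounds (P k : nat) (m : Z) : Z.le (Z.pow 2 (Z.of_nat P)) m ->
  zR (log2_approx 0 P k m) <= 2 ^+ k * lg (zR m / 2 ^+ P) <= zR (log2_approx 1 P k m).
Proof.
have p2 n : 0 < 2 ^+ n :> R by rewrite exprn_gt0.
have ex m' : Z.le (Z.pow 2 (Z.of_nat P)) m' ->
    exists e : nat, [/\ Z.sub (Z.log2 m') (Z.of_nat P) = Z.of_nat e,
      Z.le (Z.pow 2 (Z.of_nat (P + e))) m' & Z.lt m' (Z.pow 2 (Z.of_nat (P + e).+1))].
  move=> H; have := Z.log2_le_mono _ _ H; rewrite Z.log2_pow2; last lia.
  move=> H'; exists (Z.to_nat (Z.sub (Z.log2 m') (Z.of_nat P))).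
  have [] := Z.log2_spec m'; first lia.
  have -> : Z.of_nat (P + Z.to_nat (Z.sub (Z.log2 m') (Z.of_nat P))) = Z.log2 m' by lia.
  by move=> h1 h2; split=> //; first lia; rewrite Nat2Z.inj_succ; have -> :
    Z.of_nat (P + Z.to_nat (Z.sub (Z.log2 m') (Z.of_nat P))) = Z.log2 m' by lia.
move=> Hm; apply/andP; split.
- elim: k m Hm => [|k IHk] m Hm; have [e [eE elo ehi]] := ex _ Hm.
    rewrite [log2_approx _ _ _ _]/= eE Z.add_0_r zR_nat expr0 mul1r.
    have := zR_le R elo; rewrite zR_pow2 exprD -ler_pdivlMl// mulrC => H.
    by have := ler_lg (p2 e) H; rewrite lgX// lg2 mulr1.
  rewrite [log2_approx _ _ _ _]/= eE !Z.add_0_r.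
  set m1 := Z.shiftr m _; set m2 := Z.shiftr (Z.mul m1 m1) _.
  have H1 : Z.le (Z.pow 2 (Z.of_nat P)) m1 by apply: shiftr_ge; lia.
  have H2 : Z.le (Z.pow 2 (Z.of_nat P)) m2.
    apply: shiftr_ge; rewrite Nat2Z.inj_add Z.pow_add_r; lia || nia.
  have [A _] := log2_approx_step P k e (zR_gt0 R Hm) (zR_gt0 R H1) (zR_gt0 R H2).
  apply: le_trans (A _ _); first last.
  + by rewrite expr2 -zRM; have /andP[] := shiftr_bounds R (Z.mul m1 m1) P.
  + by have /andP[] := shiftr_bounds R m e.
  rewrite zRD zRM zR_nat.
  by rewrite (zR_pow2 R k.+1) lerD2l IHk.
- elim: k m Hm => [|k IHk] m Hm; have [e [eE elo ehi]] := ex _ Hm.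
    rewrite [log2_approx _ _ _ _]/= eE zRD zR_nat expr0 mul1r.
    have := zR_le R (Z.lt_le_incl _ _ ehi); rewrite zR_pow2 -addnS exprD -ler_pdivrMl// mulrC => H.
    have m0 : 0 < zR m / 2 ^+ P by rewrite divr_gt0// (zR_gt0 R Hm).
    by have := ler_lg m0 H; rewrite lgX// lg2 mulr1 -[e.+1]addn1 natrD.
  rewrite [log2_approx _ _ _ _]/= eE.
  set m1 := Z.add (Z.shiftr m _) 1; set m2 := Z.add (Z.shiftr (Z.mul m1 m1) _) 1.
  have H1 : Z.le (Z.pow 2 (Z.of_nat P)) m1.
    apply: Z.le_trans (_ : Z.le _ (Z.shiftr m (Z.of_nat e))) _.
      by apply: shiftr_ge; lia.
    by rewrite /m1; lia.
  have H2 : Z.le (Z.pow 2 (Z.of_nat P)) m2.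
    apply: Z.le_trans (_ : Z.le _ (Z.shiftr (Z.mul m1 m1) (Z.of_nat P))) _.
      apply: shiftr_ge; rewrite Nat2Z.inj_add Z.pow_add_r; lia || nia.
    by rewrite /m2; lia.
  have [_ A] := log2_approx_step P k e (zR_gt0 R Hm) (zR_gt0 R H1) (zR_gt0 R H2).
  apply: le_trans (A _ _) _.
  + by have /andP[] := shiftr_bounds R m e.
  + by rewrite expr2 -zRM; have /andP[] := shiftr_bounds R (Z.mul m1 m1) P.
  rewrite zRD zRM zR_nat.
  by rewrite (zR_pow2 R k.+1) lerD2l IHk.
Qed.

End LogBounds.

(** * Chebyshev's method *)

(* A triple (r, p, c) is a counter of period p + 1 and weight c that fires after r + 1 ticks;
   [tick] adds up the weights of the counters that fire. Divisions are thus replaced by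
   unary countdowns, which keeps the verification by computation cheap. *)
Fixpoint tick (s : seq (nat * nat * Z)) : Z * seq (nat * nat * Z) :=
  match s with
  | [::] => (Z0, [::])
  | (r, p, c) :: s' =>
      let (v, s'') := tick s' in
      match r with
      | 0%N => (Z.add c v, (p, p, c) :: s'')
      | S r' => (v, (r', p, c) :: s'')
      end
  end.

Fixpoint scan (T : nat) (v : Z) (s : seq (nat * nat * Z)) : bool :=
  match T with
  | 0%N => true
  | S T' => let (w, s') := tick s in
      let v' := Z.add v w in
      if Z.leb 0 v' then scan T' v' s' else false
  end.

Section Scan.
Variable R : realType.
Local Notation zR := (zR R).

(** Closed form of the weight fired in t ticks: for r <= p, a counter (r, p, c) fires at tick r + 1
    and then every p + 1 ticks. *)
Definition fired (s : seq (nat * nat * Z)) (t : nat) : R :=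
  \sum_(x <- s) zR x.2 * ((t + x.1.2 - x.1.1) %/ x.1.2.+1)%:R.

Lemma fired_tick s t : all (fun x => x.1.1 <= x.1.2)%N s ->
  fired s t.+1 = zR (tick s).1 + fired (tick s).2 t
  /\ all (fun x => x.1.1 <= x.1.2)%N (tick s).2.
Proof.
elim: s => [|[[r p] c] s IHs] /=; first by rewrite /fired !big_nil /zR addr0.
move=> /andP[rp /IHs{IHs}]; case: (tick s) => v s' /= [IH1 IH2].
rewrite /fired big_cons -/(fired s t.+1) IH1.
case: r rp => [|r] rp /=; rewrite big_cons -/(fired s' t) /= ?leqnn ?IH2 ?(ltnW rp); split=> //.
  rewrite zRD addnK subn0 (_ : (t.+1 + p)%N = t + p.+1)%N ?addSnnS//.
  by rewrite divnDr ?dvdnn// divnn/= natrD; ring.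
by rewrite addSn subSS addrCA.
Qed.

Lemma scanP T v s t : all (fun x => x.1.1 <= x.1.2)%N s -> scan T v s ->
  (0 < t <= T)%N -> 0 <= zR v + fired s t.
Proof.
elim: T v s t => [|T IHT] v s [|t]// sP /=.
have := fired_tick t sP; case E : (tick s) => [w s'] /= [-> sP'].
case: ifP => // vw sc tT; rewrite addrA -zRD.
case: t tT => [|t] tT; last by apply: IHT.
rewrite /fired big1_seq ?addr0; first by have := zR_leb R vw.
move=> [[r p] c] /andP[_ /(allP sP')] /= rp.
by rewrite divn_small ?mulr0// add0n ltnS leq_subr.
Qed.

End Scan.

Definition Zsum (s : seq Z) : Z := foldr Z.add Z0 s.

(* An entry (j, b) of the second list reloads with T, so it fires only once in T ticks. *)
Definition counters (T : nat) (a b : seq (nat * Z)) : seq (nat * nat * Z) :=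
  [seq (x.1.-1, x.1.-1, Z.mul x.2 (Z.of_nat x.1)) | x <- a] ++
  [seq (x.1.-1, T, x.2) | x <- b].

(* The last clause settles all t > T at once, because sum_d a_d d (t %/ d) equals
   - sum_d a_d (t %% d) when sum_d a_d = 0. *)
Definition dominates (T : nat) (a b : seq (nat * Z)) (q : Z) : bool :=
  [&& all (fun x => 0 < x.1)%N a, all (fun x => 0 < x.1 <= T)%N b,
      Z.eqb (Zsum (map snd a)) 0,
      scan T (Z.opp q) (counters T a b) &
      Z.leb q (Z.sub (Zsum (map snd b))
        (Zsum [seq Z.mul (Z.max x.2 0) (Z.of_nat x.1.-1) | x <- a]))].

Section Dominates.
Variable R : realType.
Local Notation zR := (zR R).

Lemma zR_sum (s : seq Z) : zR (Zsum s) = \sum_(z <- s) zR z.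
Proof. by elim: s => [|z s IHs]; rewrite ?big_nil// big_cons /= zRD IHs. Qed.

Lemma dominatesP T a b q t : dominates T a b q -> (0 < t)%N ->
  zR q <= \sum_(x <- a) zR x.2 * x.1%:R * (t %/ x.1)%:R
          + \sum_(x <- b) zR x.2 * (x.1 <= t)%N%:R.
Proof.
move=> /and5P[/allP a0 /allP b0 /Z.eqb_eq asum sc tail] t0.
have [tT|Tt] := leqP t T.
  have := @scanP R _ _ _ t _ sc; rewrite zRN addrC subr_ge0 t0 tT; move=> /(_ _ isT).
  rewrite /fired /counters big_cat !big_map /= => H; apply: le_trans (H _) _.
    rewrite all_cat !all_map; apply/andP; split; apply/allP => x xs /=; first exact: leqnn.
    by have /andP[_ xT] := b0 x xs; rewrite (leq_trans (leq_pred _)).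
  apply: lerD; rewrite big_seq [leRHS]big_seq; apply: ler_sum => x xs.
    have x0 := a0 _ xs; rewrite zRM zR_nat addnK prednK//.
  have /andP[] := b0 _ xs; move: (x.1 : nat) => j j0 jT.
  have -> : ((t + T - j.-1) %/ T.+1)%N = (j <= t)%N :> nat.
    case: leqP => jt /=; last by rewrite divn_small//; lia.
    by apply/eqP; rewrite eqn_leq -ltnS ltn_divLR// leq_divRL//; apply/andP; split; lia.
  by [].
have -> : \sum_(x <- b) zR x.2 * (x.1 <= t)%N%:R = zR (Zsum (map snd b)).
  rewrite zR_sum big_map big_seq [RHS]big_seq; apply: eq_bigr => x xs.
  by have /andP[_ xT] := b0 _ xs; rewrite (leq_trans xT) ?mulr1// ltnW.
have -> : \sum_(x <- a) zR x.2 * x.1%:R * (t %/ x.1)%:R =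
    - \sum_(x <- a) zR x.2 * (t %% x.1)%:R.
  have : \sum_(x <- a) zR x.2 * t%:R = 0.
    by rewrite -mulr_suml -[X in X * _](big_map snd xpredT zR) -zR_sum asum /zR mul0r.
  move=> s0; apply/eqP; rewrite -addr_eq0 -big_split /= -[X in _ == X]s0; apply/eqP.
  apply: eq_bigr => x _.
  by rewrite -mulrA -natrM -mulrDr -natrD mulnC -divn_eq.
have := zR_leb R tail; rewrite zRB => /le_trans; apply.
rewrite addrC lerD2r lerN2 zR_sum big_map big_seq [leRHS]big_seq.
apply: ler_sum => x xs; rewrite zRM zR_nat.
have x0 := a0 _ xs.
(* Only a positive coefficient can make - a_d (t %% d) negative, and then by at most a_d (d - 1). *)
have h1 : (t %% x.1)%:R <= x.1.-1%:R :> R by rewrite ler_nat -ltnS prednK// ltn_pmod.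
have h2 : zR x.2 <= zR (Z.max x.2 0) by apply: zR_le; lia.
have h3 : zR 0 <= zR (Z.max x.2 0) by apply: zR_le; lia.
by apply: le_trans (ler_wpM2r _ h2) (ler_wpM2l _ h1).
Qed.

Lemma psi_le_of_dominates T a b q n : dominates T a b q -> (0 < n)%N ->
  zR q * psi R n <= - (n%:R * \sum_(x <- a) zR x.2 * lg x.1%:R)
    + (\sum_(x <- a) `|zR x.2| * x.1%:R) * (2 + lg n%:R)
    + \sum_(x <- b) zR x.2 * psi R (n %/ x.1).
Proof.
move=> dom n0; have /and5P[/allP a0 /allP b0 /Z.eqb_eq asum _ _] := dom.
(* The sum also meets t = 0, where all terms vanish because every cutoff j in b is positive. *)
have psE : 0 <= primepow_sum n n (fun t => \sum_(x <- a) zR x.2 * x.1%:R * (t %/ x.1)%:R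
    + \sum_(x <- b) zR x.2 * (x.1 <= t)%N%:R + - zR q * (0 < t)%N%:R).
  apply: primepow_sum_ge0 => t; have [->|t0] := posnP t.
    rewrite mulr0 addr0 !big1_seq ?addr0// => x /andP[_ xs]; last by rewrite div0n mulr0.
    by have /andP[x0 _] := b0 _ xs; rewrite leqNgt x0 mulr0.
  by rewrite mulr1 subr_ge0 (dominatesP dom).
rewrite !primepow_sumD primepow_sumZ mulNr subr_ge0 !primepow_sum_sum in psE.
apply: le_trans psE _; apply: lerD; last first.
  rewrite big_seq [leRHS]big_seq; apply: ler_sum => x xs.
  by have /andP[x0 _] := b0 _ xs; rewrite primepow_sumZ psi_divn.
(* The common main term n lg n - n / ln 2 is multiplied by sum_d a_d = 0, so it can be subtracted
   freely. *)
have s0 : \sum_(x <- a) zR x.2 * (n%:R * lg n%:R - n%:R / ln 2) = 0.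
  by rewrite -mulr_suml -[X in X * _](big_map snd xpredT zR) -zR_sum asum /zR mul0r.
rewrite -[leLHS]subr0 -[X in _ - X]s0 -sumrB mulr_sumr -sumrN mulr_suml -big_split /=.
rewrite big_seq [leRHS]big_seq; apply: ler_sum => x xs.
have x0 := a0 _ xs.
rewrite primepow_sumZ -[X in _ * _ * X](@primepow_sum_divn R n x.1 (fun t => t%:R))//.
rewrite -lg_fact; have := lg_fact_divn R n0 x0.
move: (lg (n %/ x.1)`!%:R) (lg n%:R) (lg x.1%:R) (n%:R / _) => y u v w H.
have := ler_wpM2l (normr_ge0 (zR x.2)) H; rewrite -normrM => /(le_trans (ler_norm _)).
lra.
Qed.

End Dominates.

(** * Bounds on psi in fixed point arithmetic *)

Definition prec : nat := 17.

(** Approximates 2^17 lg d, working with 24 fractional bits. *)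
Definition log2_fix (r : Z) (d : nat) : Z :=
  log2_approx r 24 prec (Z.mul (Z.of_nat d) (Z.pow 2 24)).

Definition weight (a : seq (nat * Z)) : Z :=
  Zsum [seq Z.mul (Z.abs x.2) (Z.of_nat x.1) | x <- a].

(** With [offset], the coefficients of n and of 1 in the bound of [psi_le_of_dominates], after
    inserting lg n <= k + n / 2^k and the previous bounds on psi. The sign of a coefficient decides
    which approximation of the logarithm and which of alpha, beta is safe; the + 1 rounds quotients
    up. *)
Definition slope (k : nat) (a b : seq (nat * Z)) (alpha beta : Z) : Z :=
  Z.add
    (Z.add (Zsum [seq Z.mul (Z.opp x.2)
                        (log2_fix (if Z.leb 0 x.2 then Z0 else 1) x.1) | x <- a])
           (Z.mul (weight a) (Z.pow 2 (Z.of_nat (prec - k)))))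
    (Zsum [seq Z.add (Z.div (Z.mul x.2 (if Z.leb 0 x.2 then beta else alpha))
                            (Z.of_nat x.1)) 1 | x <- b]).

Definition offset (k : nat) (a b : seq (nat * Z)) (C : Z) : Z :=
  Z.add (Z.mul (weight a) (Z.of_nat k.+2)) (Z.mul C (Zsum [seq Z.abs x.2 | x <- b])).

Section Improve.
Variable R : realType.
Local Notation zR := (zR R).
Local Notation D := (2 ^+ prec : R).

(* The slopes alpha and beta are in units of 2^-17. The factor n + 1 in the lower bound
   absorbs the rounding in n %/ j <= n / j. *)
Definition psi_between (alpha beta C : Z) : Prop := forall n : nat,
  zR alpha * n.+1%:R - zR C * D <= D * psi R n <= zR beta * n%:R + zR C * D.

Lemma log2_fixP d : (0 < d)%N ->
  zR (log2_fix 0 d) <= D * lg d%:R <= zR (log2_fix 1 d).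
Proof.
move=> d0; have := @log2_approx_bounds R 24 prec (Z.mul (Z.of_nat d) (Z.pow 2 24)).
rewrite zRM zR_nat (zR_pow2 R 24) mulfK; last by rewrite lt0r_neq0 ?exprn_gt0.
by apply; lia.
Qed.

Lemma zR_abs z : zR (Z.abs z) = `|zR z|.
Proof.
have [z0|z0] := Z_le_gt_dec 0 z.
  by rewrite Z.abs_eq// ger0_norm//; have := zR_le R z0.
rewrite Z.abs_neq; last lia.
by rewrite zRN ler0_norm//; have := @zR_le R z 0 ltac:(lia).
Qed.

Lemma psi_le_slope T k a b q alpha beta C n : dominates T a b q ->
  (k <= prec)%N -> Z.le 0 alpha -> Z.le 0 beta -> psi_between alpha beta C ->
  (0 < n)%N ->
  zR q * (D * psi R n) <= zR (slope k a b alpha beta) * n%:R + zR (offset k a b C) * D.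
Proof.
move=> dom kp al0 be0 bnd n0; have /and5P[/allP a0 /allP b0 _ _ _] := dom.
have D0 : 0 < D by rewrite exprn_gt0.
have nR : 0 < n%:R :> R by rewrite ltr0n.
have alR : 0 <= zR alpha by have := zR_le R al0.
have beR : 0 <= zR beta by have := zR_le R be0.
have := ler_wpM2l (ltW D0) (psi_le_of_dominates R dom n0).
rewrite mulrCA => /le_trans; apply.
have weightE : \sum_(x <- a) `|zR x.2| * x.1%:R = zR (weight a).
  by rewrite /weight zR_sum big_map; apply: eq_bigr => x _; rewrite zRM zR_abs zR_nat.
have W0 : 0 <= zR (weight a) by rewrite -weightE sumr_ge0// => x _; rewrite mulr_ge0.
rewrite weightE /slope /offset !zRD !zRM zR_nat zR_pow2.
move: (zR (weight a)) W0 weightE => w W0 _.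
rewrite !zR_sum !big_map.
have H1 : - (D * \sum_(x <- a) zR x.2 * lg x.1%:R) <=
    \sum_(j <- a) zR (Z.mul (Z.opp j.2) (log2_fix (if Z.leb 0 j.2 then Z0 else 1) j.1)).
  rewrite mulr_sumr -sumrN big_seq [leRHS]big_seq; apply: ler_sum => x xs.
  have /andP[lo hi] := log2_fixP (a0 _ xs).
  rewrite zRM zRN mulrCA mulNr lerN2; case: ifP => x0.
    by rewrite ler_wpM2l//; have := zR_leb R x0.
  by move/Z.leb_gt/Z.lt_le_incl/(zR_le R): x0 => x0; rewrite ler_wnM2l.
have H2 : D * (2 + lg n%:R) <= D * k.+2%:R + 2 ^+ (prec - k) * n%:R.
  have := @lg_le R n%:R k nR; rewrite -(ler_pM2l D0) mulrDr.
  rewrite (_ : D * (n%:R / 2 ^+ k) = 2 ^+ (prec - k) * n%:R); last first.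
    rewrite -{1}(subnK kp) exprD -mulrA; congr (_ * _).
    by rewrite mulrC divfK// lt0r_neq0 ?exprn_gt0.
  rewrite -[k.+2]addn2 natrD [_ * (2 + _)]mulrDr.
  by move: D (2 ^+ (prec - k) : R) (lg n%:R) => d e l; lra.
have H3 : D * (\sum_(x <- b) zR x.2 * psi R (n %/ x.1)) <=
    (\sum_(j <- b) zR (Z.add (Z.div (Z.mul j.2 (if Z.leb 0 j.2 then beta else alpha))
                            (Z.of_nat j.1)) 1)) * n%:R
    + zR C * (\sum_(j <- b) zR (Z.abs j.2)) * D.
  rewrite mulr_sumr mulr_suml -mulrA mulr_suml mulr_sumr -big_split /=.
  rewrite big_seq [leRHS]big_seq; apply: ler_sum => x xs.
  have /andP[x0 _] := b0 _ xs; have x0R : 0 < x.1%:R :> R by rewrite ltr0n.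
  have /andP[lo hi] := bnd (n %/ x.1)%N.
  have x0Z : Z.lt 0 (Z.of_nat x.1) by case: (x.1 : nat) x0 => // j _; lia.
  have := @zR_div_ge R (Z.mul x.2 (if Z.leb 0 x.2 then beta else alpha)) _ x0Z.
  rewrite zRM zR_nat zR_abs.
  have h1 : (n %/ x.1)%:R <= n%:R / x.1%:R :> R.
    by rewrite ler_pdivlMr// -natrM ler_nat leq_trunc_div.
  have h2 : n%:R / x.1%:R <= (n %/ x.1).+1%:R :> R.
    by rewrite ler_pdivrMr// -natrM ler_nat ltnW// ltn_ceil.
  move: (n %/ x.1)%N (zR (Z.add _ _)) lo hi h1 h2 => m z lo hi h1 h2.
  rewrite (mulrCA D); case: ifP => c.
    have c0 : 0 <= zR x.2 by have := zR_leb R c.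
    rewrite (ger0_norm c0) => /(ler_wpM2r (ltW nR)) H.
    apply: le_trans _ (lerD H (lexx _)).
    apply: le_trans (ler_wpM2l c0 hi) _.
    rewrite [leRHS](_ : _ = zR x.2 * (zR beta * (n%:R / x.1%:R) + zR C * D)); last by ring.
    by rewrite ler_wpM2l// lerD2r ler_wpM2l.
  (* A negative coefficient calls for the lower bound on psi, together with n / j <= n %/ j + 1. *)
  move/Z.leb_gt/Z.lt_le_incl/(zR_le R): c => c0.
  rewrite (ler0_norm c0) => /(ler_wpM2r (ltW nR)) H.
  apply: le_trans _ (lerD H (lexx _)).
  apply: le_trans (ler_wnM2l c0 lo) _.
  rewrite [leRHS](_ : _ = zR x.2 * (zR alpha * (n%:R / x.1%:R) - zR C * D)); last by ring.
  by rewrite ler_wnM2l// lerD2r ler_wpM2l.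
have H2' := ler_wpM2l W0 H2.
move: H1 H2' H3.
set s1 := \sum_(x <- a) zR x.2 * lg _; set s2 := \sum_(x <- b) zR x.2 * psi _ _.
set s3 := \sum_(j <- a) zR (Z.mul _ _); set s4 := \sum_(j <- b) zR (Z.add _ _).
set s5 := \sum_(j <- b) zR (Z.abs _).
move: s1 s2 s3 s4 s5 (zR C) D (2 ^+ (prec - k) : R) (lg n%:R) (k.+2%:R : R).
move=> s1 s2 s3 s4 s5 c d e l k2 H1 H2' H3.
have := ler_wpM2r (ltW nR) H1.
lra.
Qed.

(** Certificate for one round: the first pair of lists bounds Q psi, the second bounds -Q psi. The
    clause alpha' <= C' 2^17 is the lower bound at n = 0, and the last clause pays for the factor n
    + 1 in place of n. *)
Definition improves (T k : nat) (Q : Z) (au bu al bl : seq (nat * Z))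
    (alpha beta C alpha' beta' C' : Z) : bool :=
  [&& dominates T au bu Q, dominates T al bl (Z.opp Q), (k <= prec)%N,
      [&& Z.ltb 0 Q, Z.leb 0 alpha, Z.leb 0 beta &
          Z.leb alpha' (Z.mul C' (Z.pow 2 (Z.of_nat prec)))],
      [&& Z.leb 0 C',
          Z.leb (slope k au bu alpha beta) (Z.mul Q beta') &
          Z.leb (offset k au bu C) (Z.mul Q C')],
      Z.leb (slope k al bl alpha beta) (Z.opp (Z.mul Q alpha')) &
      Z.leb (Z.add (Z.mul (offset k al bl C) (Z.pow 2 (Z.of_nat prec))) (Z.mul Q alpha'))
        (Z.mul Q (Z.mul C' (Z.pow 2 (Z.of_nat prec))))].

Lemma improvesP T k Q au bu al bl alpha beta C alpha' beta' C' :
  improves T k Q au bu al bl alpha beta C alpha' beta' C' ->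
  psi_between alpha beta C -> psi_between alpha' beta' C'.
Proof.
move=> /and5P[du dl kp /and4P[Q0 a0 b0 aC] /and3P[/and3P[C0 su ou] sl ol]] bnd n.
have D0 : 0 < D by rewrite exprn_gt0.
have QR : 0 < zR Q by rewrite /zR ltr0z; lia.
have P2E := zR_pow2 R prec; move: (Z.pow 2 (Z.of_nat prec)) P2E aC ol => P2 P2E aC ol.
have [->|n0] := posnP n.
  rewrite psi0; have := zR_leb R aC; have := zR_leb R C0; rewrite zRM P2E -[zR 0]/0.
  by rewrite !mulr0 mulr1 add0r => c0 H; rewrite subr_le0 H mulr_ge0// ltW.
have al0 : Z.le 0 alpha by lia.
have be0 : Z.le 0 beta by lia.
have U := psi_le_slope du kp al0 be0 bnd n0.
have L := psi_le_slope dl kp al0 be0 bnd n0.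
have := zR_leb R su; have := zR_leb R ou; have := zR_leb R sl; have := zR_leb R ol.
rewrite zRN mulNr in L.
rewrite zRD zRN !zRM !P2E.
move: (slope k au bu _ _) (slope k al bl _ _) (offset k au bu _) (offset k al bl _) U L.
move=> s1 s2 o1 o2; move: (zR s1) (zR s2) (zR o1) (zR o2) => {}s1 {}s2 {}o1 {}o2.
have nR : 0 < n%:R :> R by rewrite ltr0n.
move: (D * psi R n) => p U L h1 h2 h3 h4.
have k1 := ler_wpM2r (ltW nR) h4; have k2 := ler_wpM2r (ltW nR) h2.
have k3 := ler_wpM2r (ltW D0) h3.
apply/andP; split; rewrite -(ler_pM2l QR) -?natr1; lra.
Qed.

End Improve.

(** * The starting bound on psi *)

Section Start.
Variable R : realType.
Local Notation zR := (zR R).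

(** Chebyshev's argument with n! / (n %/ 2)!^2, that is, 1 <= t - 2 (t %/ 2) + [2 <= t] for t >
    0. *)
Lemma psi_half_le k n : (0 < n)%N ->
  psi R n <= psi R n./2 + n%:R * (1 + 3 / 2 ^+ k) + 3 * k.+2%:R.
Proof.
move=> n0.
have dom : dominates 2 [:: (1%N, Zpos 1); (2, Zneg 1)] [:: (2, Zpos 1)] (Zpos 1) by [].
have := psi_le_of_dominates R dom n0.
rewrite !big_cons !big_nil /= -[zR (Zpos 1)]/1 -[zR (Zneg 1)]/(-1 : R) lg1 lg2 divn2.
rewrite normrN normr1 -[k.+2]addn2 natrD.
have := @lg_le R n%:R k; rewrite ltr0n => /(_ n0).
have -> : n%:R * (1 + 3 / 2 ^+ k) = n%:R + 3 * (n%:R / 2 ^+ k) :> R by ring.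
move: (n%:R / _ : R) (lg _) (psi _ _) (psi _ _) => *; lra.
Qed.

(** Iterated halving: the linear terms form a geometric series, which doubles them, and the constant
    is paid at most 1 + lg n times. *)
Lemma psi_le_lg k n : (0 < n)%N ->
  psi R n <= (2 + 6 / 2 ^+ k) * n%:R + 3 * k.+2%:R * (1 + lg n%:R).
Proof.
have k0 : 0 <= 3 / 2 ^+ k :> R by rewrite divr_ge0 ?exprn_ge0.
have -> : 6 / 2 ^+ k = 2 * (3 / 2 ^+ k) :> R by lra.
elim/ltn_ind: n => n IHn n0; have := psi_half_le k n0.
move: (3 / 2 ^+ k) k0 IHn => e e0 IHn.
have [n1|n1] := leqP n 1.
  have -> : n = 1%N by lia.
  rewrite psi0 lg1; have : 0 <= k.+2%:R :> R by []; nra.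
have m0 : (0 < n./2)%N by rewrite half_gt0.
have := IHn n./2 ltac:(by rewrite -divn2 ltn_Pdiv) m0.
have : lg n./2%:R + 1 <= lg n%:R :> R.
  have := @lgM R n./2%:R 2; rewrite lg2 !ltr0n => /(_ m0 isT) <-.
  by rewrite -natrM ler_lg ?ltr0n ?ler_nat//; lia.
have : n./2%:R * 2 <= n%:R :> R by rewrite -natrM ler_nat; lia.
have : 0 <= k.+2%:R :> R by [].
clear IHn; move: (psi R n) (psi R n./2) => p q.
move: (lg n%:R) (lg n./2%:R) => u v.
move: (n%:R : R) (n./2%:R : R) (k.+2%:R : R) => x y z z0 yx vu IH step.
have h1 : 0 <= e * (x - y * 2) by rewrite mulr_ge0// subr_ge0.
have h2 : 0 <= z * (u - (v + 1)) by rewrite mulr_ge0// subr_ge0.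
lra.
Qed.

(** 264766 is 2.02 * 2^17 rounded up. *)
Lemma psi_between_start : psi_between R 0 264766 470.
Proof.
move=> n; rewrite -[zR 0]/0 mul0r sub0r.
have D0 : 0 < 2 ^+ prec :> R by rewrite exprn_gt0.
have C0 : 0 <= zR 470 by rewrite /zR ler0z.
apply/andP; split.
  by rewrite (le_trans _ (mulr_ge0 (ltW D0) (psi_ge0 R n)))// oppr_le0 mulr_ge0// ltW.
have [->|n0] := posnP n; first by rewrite psi0 !mulr0 add0r mulr_ge0// ltW.
(* The term 36 (1 + lg n) is at most 468 + 36 n / 2^12, by lg n <= 12 + n / 2^12. *)
have := psi_le_lg 10 n0; have := @lg_le R n%:R 12; rewrite ltr0n => /(_ n0) h1 h2.
have slopeE : 2 ^+ prec * (2 + 6 / 2 ^+ 10 + 36 / 2 ^+ 12) <= zR 264766.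
  pose z := Z.add (Z.pow 2 (Z.of_nat 18)) (Z.add
    (Z.mul (Z.of_nat 6) (Z.pow 2 (Z.of_nat 7))) (Z.mul (Z.of_nat 36) (Z.pow 2 (Z.of_nat 5)))).
  apply: le_trans (_ : zR z <= _); last by apply: zR_leb.
  rewrite /z !zRD (zRM R (Z.of_nat 6)) (zRM R (Z.of_nat 36)) (zR_nat R 6) (zR_nat R 36).
  rewrite (zR_pow2 R 18) (zR_pow2 R 7) (zR_pow2 R 5).
  by rewrite -[prec]/17%N; lra.
have offsetE : 468 <= zR 470 by rewrite -(zR_nat R 468); apply: zR_leb.
have h3 : psi R n <= (2 + 6 / 2 ^+ 10 + 36 / 2 ^+ 12) * n%:R + 468 by lra.
apply: le_trans (ler_wpM2l (ltW D0) h3) _.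
rewrite mulrDr mulrA lerD// ?ler_wpM2r//.
by rewrite mulrC ler_wpM2r// ltW.
Qed.

End Start.

Local Open Scope Z_scope.

(* The coefficients were found by linear programming. Those of the factorials are close to
   +-30030 mu(d) / d for small d, which are integers as 30030 = 2 * 3 * 5 * 7 * 11 * 13. *)
Definition upper1_fact : seq (nat * Z) := zip
  [:: 1; 2; 3; 5; 6; 7; 10; 11; 13; 14; 15; 17; 19; 20; 21; 22; 23; 24; 25;
      26; 27; 28; 29; 30; 31; 32; 33; 34; 35; 37; 38; 39; 40; 41; 42; 43; 44;
      45; 46; 47; 49; 50; 53; 54; 55; 57; 58; 59; 60]%N
  [:: 30030; -15015; -10010; -6006; 5005; -4290; 3003; -2730; -1522; 1413;
      2002; -1766; -535; -226; 699; 1365; -698; -582; 115; 650; 150; 221;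
      -204; -593; 114; -191; 282; 198; 293; -512; 268; 223; 113; -553; -259;
      -228; -29; -442; 349; 240; 19; 33; -383; 57; 240; 100; 102; -509;
      -1].

Definition upper1_psi : seq (nat * Z) := zip
  [:: 10; 56; 57; 90; 120; 300; 800; 1300; 2000]%N
  [:: 122; 4031; 4509; 12848; 10095; 6836; 8459; 10473; 251034].

Definition lower1_fact : seq (nat * Z) := zip
  [:: 1; 2; 3; 5; 6; 7; 10; 11; 13; 14; 15; 16; 17; 19; 21; 22; 23; 26; 28;
      29; 30; 31; 32; 33; 34; 35; 36; 38; 39; 42; 43; 44; 46; 47; 48; 49; 51;
      53; 55; 57; 59; 60]%N
  [:: -30030; 15015; 10010; 6006; -5005; 4290; -3003; 2730; 2310; -2145;
      -2002; 841; 975; 1581; -1321; -712; 581; -604; 473; 85; 1557; 431; -420;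
      -910; -394; -21; 324; -317; -403; 345; 573; -327; 98; 259; -4; -271;
      -111; 90; -201; -315; -59; 1].

Definition lower1_psi : seq (nat * Z) := zip
  [:: 10; 43; 70; 170; 800; 1000; 2000]%N
  [:: 2; 2302; 32587; 7176; 5007; 10663; 265355].

Definition upper2_fact : seq (nat * Z) := zip
  [:: 1; 2; 3; 5; 6; 7; 10; 11; 13; 14; 15; 17; 19; 21; 22; 23; 26; 29; 30;
      31; 32; 33; 34; 35; 37; 38; 39; 41; 42; 43; 46; 47; 50; 51; 53; 55; 56;
      57; 58; 59; 60; 62; 64; 65; 66; 67; 69; 70; 71; 72; 74; 75; 77; 78; 79;
      80; 82; 84; 85; 86; 87; 93; 94; 95; 96; 97; 100]%N
  [:: 30030; -15015; -10010; -6006; 5005; -4290; 3003; -2730; -2310; 2145;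
      2002; -1767; -1581; 1430; 1365; -1306; 1155; -872; -1159; -377; -122;
      670; 397; 536; -542; 528; 770; -733; -715; -493; 461; -378; 39; 311;
      -169; 320; -181; 123; 436; -509; 79; 24; 8; 209; -335; -165; 400; -268;
      -32; -49; 271; -167; 157; -385; -144; 42; 98; -19; 155; 135; 129; 97;
      189; 316; 41; -228; -19].

Definition upper2_psi : seq (nat * Z) := zip
  [:: 10; 34; 35; 56; 57; 71; 87; 91; 92; 93; 110; 135; 200; 250; 300; 350;
      400; 500; 800; 1000; 1300; 2000; 2500; 3000; 4000]%N
  [:: 27; 10019; 11293; 1457; 23039; -13816; 12084; 4740; 8832; 2685; -13435;
      8637; 2091; 4034; 10793; -28180; 12083; 8633; 21872; 14047; 545; 3019;
      -6645; 6619; 494314].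

Definition lower2_fact : seq (nat * Z) := zip
  [:: 1; 2; 3; 5; 6; 7; 10; 11; 13; 14; 15; 17; 19; 21; 22; 23; 26; 28; 29;
      30; 31; 33; 34; 35; 36; 38; 39; 40; 41; 42; 43; 44; 45; 46; 47; 51; 52;
      53; 55; 56; 57; 58; 59; 60; 61; 62; 65; 66; 67; 69; 72; 73; 79; 80; 81;
      82; 83; 84; 85; 86; 89; 90; 93; 95; 96; 98; 99; 100]%N
  [:: -30030; 15015; 10010; 6006; -5005; 4290; -3003; 2730; 2310; -2145;
      -2002; 1767; 1581; -1430; -976; 933; -1155; 190; 576; 1001; 969; -910;
      -883; -152; 148; -774; -507; 267; 200; 715; 698; -195; 186; -71; 74;
      -418; 36; 367; -546; 16; -11; -288; 66; 213; 126; -484; -128; 455; -4;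
      54; -74; 135; 242; -27; -106; -100; 362; -63; -353; -349; 150; -93; 138;
      -170; 35; 232; 217; -58].

Definition lower2_psi : seq (nat * Z) := zip
  [:: 29; 71; 73; 110; 120; 170; 250; 300; 500; 600; 800; 1300; 1600; 2000;
      2500; 3000; 4000]%N
  [:: 8318; 10147; 20269; 45084; -66578; 29762; 8714; 3711; 8993; 28286;
      -16845; 5053; 22589; -17665; 20400; -10907; 471156].

Local Close Scope Z_scope.

Section Stages.
Variable R : realType.

(** In units of 1 the slopes are about 1.367 and 1.516, around the true value 1 / ln 2 = 1.4427. The
    scan runs to 2000, the largest cutoff j, and logarithms are absorbed with k = 14. *)
Lemma psi_between_first : psi_between R 179215 198760 5465.
Proof.
apply: (@improvesP R 2000 14 30030 upper1_fact upper1_psi lower1_fact lower1_psi)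
  (psi_between_start R).
by vm_compute.
Qed.

(** The ratio 195014 / 182945 is below 1.066, hence below 15/14 = 1.0714. *)
Lemma psi_between_second : psi_between R 182945 195014 145369.
Proof.
apply: (@improvesP R 4000 17 30030 upper2_fact upper2_psi lower2_fact lower2_psi)
  psi_between_first.
by vm_compute.
Qed.

End Stages.

(** * Primes between 14 n and 15 n *)

Lemma ex_sqrt (M : nat) : exists s, (s * s <= M < s.+1 * s.+1)%N.
Proof.
elim: M => [|M [s /andP[h1 h2]]]; first by exists 0%N.
have [h|h] := leqP (s.+1 * s.+1) M.+1; last by exists s; rewrite h (leq_trans h1).
by exists s.+1; rewrite h (leq_trans (_ : M.+1 < M.+2)%N)//; nia.
Qed.

Section PrimeGap.
Variable R : realType.
Local Notation zR := (zR R).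

Lemma zR_ler x y : zR x <= zR y -> Z.le x y.
Proof. by rewrite /zR ler_int; lia. Qed.

Lemma sum_at_most_one (r : seq nat) (P : pred nat) : uniq r ->
  (forall i j, i \in r -> j \in r -> P i -> P j -> i = j) ->
  \sum_(i <- r) (P i)%:R <= 1 :> R.
Proof.
move=> ur Pinj; have [/hasP[i ir Pi]|/hasPn noP] := boolP (has P r).
  rewrite (bigD1_seq i)//= Pi big1_seq ?addr0// => j /andP[ji jr].
  by case Pj : (P j) => //; rewrite (Pinj _ _ ir jr Pi Pj) eqxx in ji.
by rewrite big1_seq// => j /andP[_ jr]; rewrite (negbTE (noP _ jr)).
Qed.

(* Only proper powers contribute, at most one for each prime p <= s since M <= 2 N. *)
Lemma psi_sub_le (N M s : nat) : (N <= M <= 2 * N)%N -> (s * s <= M < s.+1 * s.+1)%N ->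
  (forall p, prime p -> (N < p <= M)%N = false) ->
  psi R M - psi R N <= s%:R * lg s%:R.
Proof.
move=> /andP[NM M2N] /andP[sM Ms] noprime.
have sleM : (s <= M)%N by rewrite (leq_trans _ sM)//; case: (s) => // s'; rewrite leq_pmulr.
rewrite /psi -(@primepow_sum_widen R M N)// /primepow_sum -sumrB.
have step p : prime p -> \sum_(1 <= k < M.+1) lg p%:R * (0 < M %/ p ^ k)%N%:R
    - \sum_(1 <= k < M.+1) lg p%:R * (0 < N %/ p ^ k)%N%:R
    = lg p%:R * \sum_(1 <= k < M.+1) (N < p ^ k <= M)%N%:R :> R.
  move=> pp; rewrite -sumrB mulr_sumr; apply: eq_bigr => k _.
  rewrite !divn_gt0 ?expn_gt0 ?prime_gt0// -mulrBr; congr (_ * _).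
  have [h1|h1] := leqP (p ^ k) N; first by rewrite (leq_trans h1 NM) subrr.
  by rewrite subr0.
under eq_bigr do rewrite step//.
(* A prime p > s contributes nothing: p itself is excluded by hypothesis, and p^2 > M. *)
rewrite (big_cat_nat (n := s.+1))//= [X in _ + X]big1_seq ?addr0; last first.
  move=> p /andP[pp]; rewrite mem_index_iota => /andP[sp _].
  rewrite big1_seq ?mulr0// => k /andP[_]; rewrite mem_index_iota => /andP[k0 _].
  case: k k0 => [//|[|k] _]; first by rewrite expn1 noprime.
  rewrite [(_ <= M)%N]leqNgt (_ : (M < _)%N) ?andbF//.
  apply: leq_trans Ms _; rewrite !expnS mulnA -[leqLHS]muln1.
  by rewrite leq_mul// ?leq_mul// expn_gt0 prime_gt0.
apply: (@le_trans _ _ (\sum_(0 <= p < s.+1 | prime p) lg s%:R)).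
  rewrite big_seq_cond [leRHS]big_seq_cond; apply: ler_sum => p.
  rewrite mem_index_iota => /andP[/andP[_ ps] pp].
  apply: (@le_trans _ _ (lg p%:R * 1)); last by rewrite mulr1 ler_lg ?ltr0n ?prime_gt0// ler_nat.
  rewrite ler_wpM2l ?lg_ge0// (sum_at_most_one (P := fun k => N < p ^ k <= M)%N) ?iota_uniq//.
  move=> i j _ _.
  have p1 := prime_gt1 pp.
  have aux a b : (a < b)%N -> (N < p ^ a)%N -> (p ^ b <= M)%N -> False.
    move=> ab Na bM; have : (p ^ a * 2 <= p ^ b)%N.
      rewrite -(subnKC ab) expnD expnS mulnC -mulnA leq_mul// -[leqLHS]muln1.
      by rewrite leq_mul ?expn_gt0 ?prime_gt0.
    lia.
  move=> /andP[h1 h2] /andP[h3 h4]; case: (ltngtP i j) => // ij.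
    by case: (aux _ _ ij h1 h4).
  by case: (aux _ _ ij h3 h2).
rewrite big_mkcond big_ltn//= add0r.
apply: (@le_trans _ _ (\sum_(1 <= p < s.+1) lg s%:R)); last first.
  by rewrite sumr_const_nat subn1 mulr_natl.
by apply: ler_sum => p _; case: ifP => // _; exact: lg_ge0.
Qed.

(** Multiplying by 2^17 and inserting lg s <= 13 + s / 2^13 leaves an inequality between integers.
    The exponent 13 suits s near sqrt(15 * 4000000), about 7746. *)
Lemma psi_gap_Z alpha beta C (N M s : nat) : psi_between R alpha beta C -> (0 < s)%N ->
  psi R M - psi R N <= s%:R * lg s%:R ->
  Z.le (Z.sub (Z.sub (Z.mul alpha (Z.of_nat M.+1)) (Z.mul C (Z.pow 2 (Z.of_nat prec))))
              (Z.add (Z.mul beta (Z.of_nat N)) (Z.mul C (Z.pow 2 (Z.of_nat prec)))))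
       (Z.add (Z.mul (Z.mul 13 (Z.pow 2 (Z.of_nat prec))) (Z.of_nat s))
              (Z.mul (Z.pow 2 (Z.of_nat 4)) (Z.mul (Z.of_nat s) (Z.of_nat s)))).
Proof.
move=> bnd s0 gap; apply: zR_ler.
have sR : 0 < s%:R :> R by rewrite ltr0n.
have E := zR_pow2 R 4; have PE := zR_pow2 R prec.
have D0 : 0 < 2 ^+ prec :> R by rewrite exprn_gt0.
have D4 : 2 ^+ prec = 2 ^+ 4 * 2 ^+ 13 :> R by rewrite -exprD.
have := ler_wpM2l (ltW D0) (le_trans gap (ler_wpM2l (ltW sR) (lg_le 13 sR))).
have -> : 2 ^+ prec * (s%:R * (13 + s%:R / 2 ^+ 13)) =
    13 * 2 ^+ prec * s%:R + 2 ^+ 4 * (s%:R * s%:R) :> R.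
  by rewrite D4; field.
have /andP[lo _] := bnd M; have /andP[_ hi] := bnd N.
move: (Z.pow 2 (Z.of_nat prec)) (Z.pow 2 (Z.of_nat 4)) E PE => P Q E PE.
rewrite !zRB !zRD !zRM !zR_nat E PE -[zR 13]/13.
move: (2 ^+ prec : R) (2 ^+ 4 : R) lo hi => d e lo hi; rewrite mulrBr => up.
exact: le_trans (lerB lo hi) up.
Qed.

Lemma prime_between_14_15 (n : nat) : Z.le 4000000 (Z.of_nat n) ->
  exists2 p, prime p & (14 * n < p <= 15 * n)%N.
Proof.
move=> nbig.
have [/hasP[p _ /andP[pp np]]|/hasPn noprime] :=
  boolP (has (fun p => prime p && (14 * n < p <= 15 * n)%N) (iota 0 (15 * n).+1)).
  by exists p.
have {}noprime p : prime p -> (14 * n < p <= 15 * n)%N = false.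
  move=> pp; apply/negP => np; have := noprime p; rewrite mem_iota pp np add0n ltnS.
  by have /andP[_ ->] := np => /(_ isT).
have [s sP] := ex_sqrt (15 * n); have /andP[sn _] := sP.
have := psi_sub_le _ sP noprime; rewrite leq_mul2r orbT (_ : 15 * n <= 2 * (14 * n))%N; last by lia.
move=> /(_ isT) gap.
have s0 : (0 < s)%N by case: (s) sP => //; lia.
(* The left side grows with slope 15 * 182945 - 14 * 195014 = 13979 in n; on the right 16 s^2 <= 240
   n, and the rest is of order sqrt n. *)
have := psi_gap_Z (psi_between_second R) s0 gap.
rewrite -[Z.of_nat prec]/(Zpos 17).
move: (ltac:(lia) : Z.le (Z.mul (Z.of_nat s) (Z.of_nat s)) (Z.mul 15 (Z.of_nat n))).
have -> : Z.of_nat (15 * n).+1 = Z.add (Z.mul 15 (Z.of_nat n)) 1 by lia.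
have -> : Z.of_nat (14 * n) = Z.mul 14 (Z.of_nat n) by lia.
move: (Z.of_nat n) (Z.of_nat s) nbig => u v u0 vu ineq; exfalso.
(* AM-GM: 2 * 8000 v <= v^2 + 8000^2 *)
have := Z.square_nonneg (Z.sub v 8000); lia.
Qed.
End PrimeGap.

(** * Primality by trial division and chains of primes *)

Definition residues30 : seq Z :=
  [:: Zpos 7; Zpos 11; Zpos 13; Zpos 17; Zpos 19; Zpos 23; Zpos 29; Zpos 31].

Definition divides (d p : Z) : bool := Z.eqb (Z.modulo p d) Z0.

(** The candidates b + o, with b a multiple of 30 and o running over the numbers from 7 to 36
    coprime to 30, are all the integers d >= 7 coprime to 30. Running out of fuel counts as
    failure. *)
Fixpoint trial (fuel : nat) (b p : Z) : bool :=
  if Z.ltb p (Z.mul (Z.add b 7) (Z.add b 7)) then true else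
  match fuel with
  | 0%N => false
  | S f => if has (fun o => divides (Z.add b o) p) residues30 then false
           else trial f (Z.add b 30) p
  end.

Lemma trialE f b p : trial f b p =
  if Z.ltb p (Z.mul (Z.add b 7) (Z.add b 7)) then true else
  if f is f'.+1 then
    if has (fun o => divides (Z.add b o) p) residues30 then false
    else trial f' (Z.add b 30) p
  else false.
Proof. by case: f. Qed.

Lemma mem_residues30 o : Z.le 7 o -> Z.le o 36 ->
  ~~ divides 2 o -> ~~ divides 3 o -> ~~ divides 5 o -> o \in residues30.
Proof.
move=> o7 o36; have : Z.to_nat o \in iota 7 30 by rewrite mem_iota; lia.
rewrite -{2 3 4 5}(Z2Nat.id o); last lia.
move: (Z.to_nat o) => j ji d2 d3 d5.
have /allP/(_ j ji) : all (fun j => [|| divides 2 (Z.of_nat j), divides 3 (Z.of_nat j),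
  divides 5 (Z.of_nat j) | Z.of_nat j \in residues30]) (iota 7 30) by vm_compute.
by rewrite (negbTE d2) (negbTE d3) (negbTE d5).
Qed.

Lemma divides_add_mul m i o : m != Z0 -> divides m (Z.add (Z.mul m i) o) = divides m o.
Proof.
by move=> m0; rewrite /divides Z.add_comm Z.mul_comm Z.mod_add//; apply/eqP.
Qed.

(** Either d lies in a later block, which the induction covers, or d - 30 i is between 7 and 36 and
    coprime to 30, so d was tried in this block. *)
Lemma trialP f i p d : trial f (Z.mul 30 i) p -> Z.le 0 i ->
  ~~ divides 2 d -> ~~ divides 3 d -> ~~ divides 5 d ->
  Z.le (Z.add (Z.mul 30 i) 7) d -> Z.le (Z.mul d d) p -> ~~ divides d p.
Proof.
have stop b : Z.ltb p (Z.mul (Z.add b 7) (Z.add b 7)) -> Z.le 0 b ->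
  Z.le (Z.add b 7) d -> Z.le (Z.mul d d) p -> ~~ divides d p by nia.
move=> + + d2 d3 d5; elim: f i => [|f IHf] i; rewrite trialE.
  by case: ifP => // H _ i0 di dp; apply: (stop _ H) => //; clear -i0; lia.
case: ifP => [H _ i0 di dp|_]; first by apply: (stop _ H) => //; clear -i0; lia.
case: ifP => // /negbT nd tr i0 di dp.
have E : Z.add (Z.mul 30 i) 30 = Z.mul 30 (Z.add i 1) by ring.
rewrite E in tr.
have [h|h] := Z_le_gt_dec (Z.add (Z.mul 30 (Z.add i 1)) 7) d.
  by apply: (IHf _ tr) => //; clear -i0; lia.
have := hasPn nd (Z.sub d (Z.mul 30 i)); rewrite Zplus_minus; apply.
have shift m c : m != Z0 -> Z.mul m c = Zpos 30 ->
    divides m (Z.sub d (Z.mul 30 i)) = divides m d.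
  move=> m0 mc; rewrite -(divides_add_mul (Z.mul c i))// Z.mul_assoc mc.
  by rewrite Zplus_minus.
apply: mem_residues30.
- by clear -di; lia.
- by clear -h; lia.
- by rewrite (shift _ 15).
- by rewrite (shift _ 10).
- by rewrite (shift _ 6).
Qed.

(** 300 blocks of 30 reach the candidate 9007, whose square exceeds every number tested. *)
Definition primeZ (p : Z) : bool :=
  [&& Z.ltb 1 p, ~~ divides 2 p, ~~ divides 3 p, ~~ divides 5 p & trial 300 Z0 p].

Lemma divides_nat m n : (0 < m)%N -> divides (Z.of_nat m) (Z.of_nat n) = (m %| n)%N.
Proof.
move=> m0; rewrite /divides /dvdn.
have -> : Z.modulo (Z.of_nat n) (Z.of_nat m) = Z.of_nat (n %% m).
  apply/esym/(Z.mod_unique _ _ (Z.of_nat (n %/ m))); first by left; have := ltn_pmod n m0; lia.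
  by rewrite {1}(divn_eq n m); lia.
by case: (n %% m)%N.
Qed.

(** A composite n has a prime divisor q with q^2 <= n. It is coprime to 30 because n is, so q >= 7
    and trial division would have found it. *)
Lemma primeZP p : primeZ p -> prime (Z.to_nat p).
Proof.
move=> pP; have pE : p = Z.of_nat (Z.to_nat p).
  by rewrite Z2Nat.id//; case/and5P: pP => p1 _ _ _ _; clear -p1; lia.
move: pP; rewrite pE Nat2Z.id; move: (Z.to_nat p) => n /and5P[p1 d2 d3 d5 tr].
apply: contraT => /primePns[|[q [qp qq qd]]]; first by clear -p1; lia.
have ndvd m : (0 < m)%N -> ~~ divides (Z.of_nat m) (Z.of_nat n) ->
    ~~ divides (Z.of_nat m) (Z.of_nat q).
  by move=> m0; rewrite !divides_nat//; apply: contra => /dvdn_trans; apply.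
have {d2}d2 := ndvd 2 isT d2; have {d3}d3 := ndvd 3 isT d3; have {d5}d5 := ndvd 5 isT d5.
have q7 : (7 <= q)%N.
  have d2' : ~~ (2 %| q)%N by rewrite -divides_nat.
  have d3' : ~~ (3 %| q)%N by rewrite -divides_nat.
  have d5' : ~~ (5 %| q)%N by rewrite -divides_nat.
  move: (prime_gt1 qp) d2' d3' d5'; clear.
  by case: q => [|[|[|[|[|[|[|]]]]]]].
have := @trialP _ 0 _ (Z.of_nat q) tr; rewrite divides_nat ?qd//; last by clear -q7; lia.
move=> /(_ (Z.le_refl 0) d2 d3 d5); apply; first by clear -q7; lia.
by clear -qq; lia.
Qed.

Fixpoint prime_chain (p : Z) (s : seq Z) : bool :=
  match s with
  | [::] => true
  | q :: s' => [&& Z.ltb p q, Z.leb (Z.mul 14 q) (Z.mul 15 p), primeZ q & prime_chain q s']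
  end.

Lemma prime_chain_cons p q s : prime_chain p (q :: s) =
  [&& Z.ltb p q, Z.leb (Z.mul 14 q) (Z.mul 15 p), primeZ q & prime_chain q s].
Proof. by []. Qed.

(** The first member q of the chain beyond x works: its predecessor is at most x. *)
Lemma prime_chainP p s x : prime_chain p s -> Z.le p x -> Z.lt x (last p s) ->
  exists2 q, prime (Z.to_nat q) & Z.lt x q /\ Z.le (Z.mul 14 q) (Z.mul 15 x).
Proof.
elim: s p => [|q s IHs] p; first by move=> _; rewrite [last _ _]/=; lia.
rewrite prime_chain_cons => /and4P[pq qp qP ch] px xl.
have [h|h] := Z_le_gt_dec q x; first exact: IHs ch h xl.
by exists q; [exact: primeZP|lia].
Qed.

Local Open Scope Z_scope.

(* Each prime is the largest one below 15/14 times its predecessor, and the last one exceeds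
   14 * 4000000. No such chain passes the gap between 113 and 127. *)
Definition chain199 : seq Z :=
  [:: 211; 223; 233; 241; 257; 271; 283; 293; 313; 331; 353; 373; 397; 421;
      449; 479; 509; 541; 577; 617; 661; 701; 751; 797; 853; 911; 971; 1039;
      1109; 1187; 1259; 1327; 1409; 1499; 1601; 1709; 1831; 1951; 2089; 2237;
      2393; 2557; 2731; 2917; 3121; 3343; 3581; 3833; 4099; 4391; 4703; 5023;
      5381; 5749; 6151; 6581; 7043; 7541; 8069; 8641; 9257; 9907; 10613;
      11369; 12163; 13009; 13933; 14923; 15973; 17107; 18313; 19609; 21001;
      22501; 24107; 25819; 27653; 29611; 31723; 33967; 36389; 38977; 41761;
      44741; 47933; 51349; 55009; 58937; 63131; 67631; 72461; 77621; 83137;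
      89071; 95429; 102241; 109541; 117361; 125743; 134707; 144323; 154621;
      165653; 177481; 190147; 203713; 218249; 233837; 250501; 268343; 287503;
      308027; 330019; 353567; 378821; 405871; 434857; 465917; 499189; 534841;
      573031; 613957; 657809; 704783; 755107; 809041; 866819; 928703; 995023;
      1066067; 1142201; 1223777; 1311181; 1404833; 1505177; 1612679; 1727851;
      1851259; 1983491; 2125163; 2276957; 2439571; 2613817; 2800513; 3000541;
      3214837; 3444449; 3690473; 3954077; 4236461; 4539013; 4863223; 5210591;
      5582771; 5981539; 6408791; 6866551; 7357003; 7882489; 8445523; 9048773;
      9695099; 10387603; 11129537; 11924503; 12776251; 13688819; 14666579;
      15714191; 16836629; 18039233; 19327747; 20708297; 22187461; 23772277;
      25470257; 27289553; 29238787; 31327229; 33564877; 35962309; 38531029;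
      41283241; 44232043; 47391439; 50776519; 54403409; 58289339].

Local Close Scope Z_scope.

Lemma prime_chain199 : prime_chain 199 chain199.
Proof. by vm_compute. Qed.

(** * Primes in (k n, (k+1) n) for the five values of k *)

Lemma small_prime_intervals : all (fun k => all (fun n =>
  has prime (index_iota (k * n).+1 (k.+1 * n))) (iota 2 37)) [:: 2; 3; 5; 9; 14]%N.
Proof. by vm_compute. Qed.

Lemma prime_interval_small k n : k \in [:: 2; 3; 5; 9; 14]%N -> (1 < n < 39)%N ->
  exists2 p, prime p & (k * n < p < k.+1 * n)%N.
Proof.
move=> kin nI; have := allP (allP small_prime_intervals k kin) n; rewrite mem_iota => /(_ nI).
by move=> /hasP[p]; rewrite mem_index_iota => pI pp; exists p.
Qed.

Lemma prime_interval_14 (R : realType) n : (1 < n)%N ->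
  exists2 p, prime p & (14 * n < p < 15 * n)%N.
Proof.
move=> n1; have [n39|n39] := ltnP n 39; first by apply: (@prime_interval_small 14); rewrite ?n1.
(* The right endpoint can be included because 15 n is composite. *)
suff [p pp /andP[p1 p2]] : exists2 p, prime p & (14 * n < p <= 15 * n)%N.
  exists p => //; rewrite p1 ltn_neqAle p2 andbT; apply: contraL pp => /eqP ->.
  by apply/primePn; right; exists 15%N; rewrite ?dvdn_mulr//; lia.
have [big|small] := Z_le_gt_dec 4000000 (Z.of_nat n); first exact: prime_between_14_15 R n big.
have [||q qp [q1 q2]] := prime_chainP prime_chain199 (x := Z.of_nat (14 * n)).
- by lia.
- by rewrite (_ : last _ _ = Zpos 58289339)//; lia.
by exists (Z.to_nat q) => //; lia.
Qed.

Lemma prime_interval (R : realType) k n : k \in [:: 2; 3; 5; 9; 14]%N -> (1 < n)%N ->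
  exists2 p, prime p & (k * n < p < k.+1 * n)%N.
Proof.
move=> kin n1; have [n39|n39] := ltnP n 39; first by apply: prime_interval_small; rewrite ?n1.
have [->|k14] := eqVneq k 14%N; first exact: prime_interval_14 R n n1.
have k9 : (1 < k <= 9)%N by move: kin k14; rewrite !inE; lia.
(* n' is the least integer with 14 n' >= k n. Then 15 n' <= (k+1) n follows from (14 - k) n >= 195,
   which for k = 9 means n >= 39. *)
have [|p pp pI] := @prime_interval_14 R ((k * n + 13) %/ 14).
  by rewrite leq_divRL//; nia.
exists p => //; have := leq_trunc_div (k * n + 13) 14.
have := ltn_ceil (k * n + 13) (isT : (0 < 14)%N).
by move: (_ %/ _)%N pI => m; nia.
Qed.

Lemma prime_threshold_1_2 (R : realType) k : k \in [:: 2; 3; 5; 9; 14]%N ->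
  prime_threshold k 1 2.
Proof.
move=> kin; split=> // [n n2|[|[|s]]//].
  have [p pp pI] := prime_interval R kin n2.
  by rewrite -has_count; apply/hasP; exists p; rewrite ?mem_index_iota.
(* The threshold 1 fails at n = 1, since (k, k + 1) contains no integer. *)
by move=> _ /(_ 1%N isT); rewrite !muln1 /index_iota subnn.
Qed.

(** * Ramanujan numbers *)

Lemma count_index_iota (T : pred nat) a b : (a <= b)%N ->
  count T (index_iota 0 b) = (count T (index_iota 0 a) + count T (index_iota a b))%N.
Proof. by move=> ab; rewrite /index_iota !subn0 -{1}(subnKC ab) iotaD count_cat. Qed.

Lemma truncn_div_ratio (R : realType) (k x : nat) : (0 < k)%N ->
  Num.truncn (x%:R / (k.+1%:R / k%:R) : R) = (x * k %/ k.+1)%N.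
Proof.
move=> k0; apply/eqP; rewrite truncn_eq; last by rewrite !divr_ge0.
have kR : 0 < k%:R :> R by rewrite ltr0n.
have -> : x%:R / (k.+1%:R / k%:R) = (x * k)%:R / k.+1%:R :> R.
  by rewrite invf_div natrM mulrA.
rewrite ler_pdivlMr ?ltr0n// ltr_pdivrMr ?ltr0n// -!natrM ler_nat ltr_nat.
by rewrite leq_trunc_div ltn_ceil.
Qed.

Section Ramanujan.
Variables (R : realType) (k m r : nat).
Hypotheses (k1 : (1 <= k)%N) (m2 : (2 <= m)%N).
Hypothesis ram : ramanujan (k.+1%:R / k%:R : R) m r.

Let diff x := (primepi (x%:R : R) - primepi (x%:R / (k.+1%:R / k%:R) : R))%N.

Let enough N := forall n : nat, (N <= n)%N ->
  (m <= count prime (index_iota (k * n).+1 (k.+1 * n)))%N.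

Lemma primepi_diff n e : (e * k < k.+1)%N ->
  diff (k.+1 * n + e) = count prime (index_iota (k * n).+1 (k.+1 * n + e).+1).
Proof.
move=> ek; rewrite /diff primepi_nat /primepi truncn_div_ratio//.
have -> : ((k.+1 * n + e) * k %/ k.+1 = k * n)%N.
  by rewrite mulnDl -mulnA mulnC divnMDl// (divn_small ek) addn0 mulnC.
rewrite (@count_index_iota _ (k * n).+1 (k.+1 * n + e).+1) ?addKn//.
by rewrite ltnS mulSn; lia.
Qed.

(** The condition on r at x = (k+1) n counts primes in (k n, (k+1) n], and the right endpoint is not
    prime when n > 1. *)
Lemma enough_of_ramanujan N : (r <= k.+1 * N)%N -> enough N.
Proof.
move=> rN n Nn; have [_ /(_ (k.+1 * n)%N) + _] := ram.
rewrite (leq_trans rN) ?leq_mul2l ?Nn ?orbT// => /(_ isT).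
have := @primepi_diff n 0; rewrite mul0n addn0 /diff => ->//.
rewrite /index_iota subSS; case E : (k.+1 * n - k * n)%N => [|d].
  by rewrite /= => /(leq_trans m2).
have -> : (k.+1 * n - (k * n).+1 = d)%N by lia.
rewrite -[d.+1]addn1 iotaD count_cat/= addn0 (_ : (_ + d)%N = (k.+1 * n)%N); last by lia.
(* At n = 1 the endpoint k + 1 may be prime, but the half-open interval then holds one integer only,
   against m >= 2. *)
have [n1|n1] := leqP n 1.
  have -> : d = 0%N by nia.
  by case: (prime _) => /= /(leq_trans m2).
rewrite [prime (k.+1 * n)](_ : _ = false) ?addn0//.
by apply/negbTE/primePn; right; exists n; rewrite ?dvdn_mull//; nia.
Qed.

(** Otherwise r - 1 = (k+1) t + e would already satisfy the condition that defines r: at x = r - 1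
    the primes counted include those in (k t, (k+1) t). The values e = 0, 1 correspond to the
    residues 1 and 2 of r. *)
Lemma ramanujan_le_of_enough t e : (0 < t)%N -> (e <= 1)%N -> r = (k.+1 * t + e.+1)%N ->
  ~ enough t.
Proof.
move=> t0 e1 rE /(_ t (leqnn t)) mt; have [r0 rP rmin] := ram.
have ek : (e * k < k.+1)%N by case: e e1 {rE} => [|[|]]//; rewrite mul1n.
suff : (r <= k.+1 * t + e)%N by rewrite rE; lia.
apply: rmin => [|x]; first by rewrite addn_gt0 muln_gt0 t0.
rewrite leq_eqVlt => /predU1P[<-|]; last by rewrite -addnS -rE => /rP.
rewrite -/(diff _) primepi_diff//; apply: leq_trans mt _.
rewrite /index_iota (_ : (k.+1 * t + e).+1 - _ = (k.+1 * t - (k * t).+1) + e.+1)%N.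
  by rewrite iotaD count_cat leq_addr.
by nia.
Qed.

Lemma ceil_div_succ N : (r <= k.+1 * N < r + k.+1)%N ->
  Num.ceil (r%:R / k.+1%:R : R) = N%:Z.
Proof.
move=> /andP[h1 h2]; apply: ceil_def.
rewrite ler_pdivrMr ?ltr0n// ltr_pdivlMr ?ltr0n// -!pmulrn -natrM ler_nat mulnC h1 andbT.
rewrite intrB mulrBl mul1r ltrBlDr -pmulrn -natrM -natrD ltr_nat.
by rewrite mulnC.
Qed.

(** Existence of N_k(m): [enough] is made decidable classically in order to take its least positive
    solution. *)
Lemma threshold_le N : (0 < N)%N -> enough N ->
  exists N', prime_threshold k m N' /\ (N' <= N)%N.
Proof.
move=> N0 PN; have ex : exists N', (0 < N')%N && `[< enough N' >].
  by exists N; rewrite N0; apply/asboolP.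
case: (ex_minnP ex) => N' /andP[N'0 /asboolP PN'] minN'; exists N'; split.
  by split=> // s s0 Ps; apply: minN'; rewrite s0; apply/asboolP.
by apply: minN'; rewrite N0; apply/asboolP.
Qed.

(** t + 1 is large enough as r <= (k+1) (t+1), and a smaller threshold would make t large enough. *)
Lemma threshold_eq t e : (e <= 1)%N -> r = (k.+1 * t + e.+1)%N ->
  prime_threshold k m t.+1.
Proof.
move=> e1 rE; split=> // [|s s0 Ps]; first by apply: enough_of_ramanujan; rewrite rE; nia.
rewrite ltnNge; apply/negP => st.
apply: (ramanujan_le_of_enough (leq_trans s0 st) e1 rE) => n tn.
exact: Ps (leq_trans st tn).
Qed.

End Ramanujan.

Lemma modn_eq_add (k r c : nat) : (c <= r)%N -> r = c %[mod k.+1] ->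
  exists t, r = (k.+1 * t + c)%N.
Proof.
move=> cr /eqP; rewrite eqn_mod_dvd// => /dvdnP[t tE].
by exists t; rewrite mulnC -tE subnK.
Qed.

Theorem proposition9 (R : realType) :
  [/\ forall k : nat, k \in [:: 2; 3; 5; 9; 14]%N -> prime_threshold k 1 2,
      forall k m r : nat, (1 <= k)%N -> (2 <= m)%N ->
        ramanujan (k.+1%:R / k%:R : R) m r ->
        exists N : nat, prime_threshold k m N /\
          N%:Z <= Num.ceil (r%:R / k.+1%:R : R),
      forall k m r : nat, (1 <= k)%N -> (2 <= m)%N ->
        ramanujan (k.+1%:R / k%:R : R) m r ->
        r = 1 %[mod k.+1] ->
        exists N : nat, [/\ prime_threshold k m N,
          N%:Z = Num.ceil (r%:R / k.+1%:R : R) &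
          N%:R = (r%:R + k%:R) / k.+1%:R :> R]
    & forall k m r : nat, (1 <= k)%N -> (2 <= m)%N ->
        ramanujan (k.+1%:R / k%:R : R) m r ->
        r = 2 %[mod k.+1] ->
        exists N : nat, [/\ prime_threshold k m N,
          N%:Z = Num.ceil (r%:R / k.+1%:R : R) &
          N%:R = (r%:R + k%:R - 1) / k.+1%:R :> R]].
Proof.
split=> [k kin|k m r k1 m2 ram|k m r k1 m2 ram rmod|k m r k1 m2 ram rmod].
- exact: prime_threshold_1_2 R k kin.
(* This N is r / (k+1) rounded up. *)
- have [r0 _ _] := ram; pose N := ((r + k) %/ k.+1)%N.
  have NI : (r <= k.+1 * N < r + k.+1)%N.
    have := leq_trunc_div (r + k) k.+1; have := ltn_ceil (r + k) (ltn0Sn k).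
    by rewrite -/N; nia.
  have N0 : (0 < N)%N by rewrite divn_gt0//; lia.
  have /andP[rN _] := NI.
  have [N' [PN' N'N]] := threshold_le N0 (enough_of_ramanujan k1 m2 ram rN).
  by exists N'; rewrite (ceil_div_succ R NI) lez_nat.
- have [r0 _ _] := ram; have [t rE] := modn_eq_add r0 rmod.
  exists t.+1; split; first exact: threshold_eq k1 m2 ram _ _ _ rE.
    by rewrite (@ceil_div_succ R k r t.+1)// rE; nia.
  have k0 : k.+1%:R != 0 :> R by rewrite pnatr_eq0.
  by apply: (canRL (mulfK k0)); rewrite -natrM -natrD; congr (_%:R); rewrite rE; lia.
- have [r0 _ _] := ram.
  (* r = 1 is impossible, as 1 and 2 are not congruent modulo k + 1 >= 2. *)
  have r2 : (2 <= r)%N.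
    case: r r0 ram rmod => [|[|]]// _ _; rewrite modn_small//.
    by case: k k1 => [|[|[|]]].
  have [t rE] := modn_eq_add r2 rmod.
  exists t.+1; split; first exact: threshold_eq k1 m2 ram _ _ _ rE.
    by rewrite (@ceil_div_succ R k r t.+1)// rE; nia.
  have k0 : k.+1%:R != 0 :> R by rewrite pnatr_eq0.
  apply: (canRL (mulfK k0)); rewrite -natrM -natrD -[X in _ - X]/(1%:R) -natrB; last by lia.
  by congr (_%:R); rewrite rE; lia.
Qed.
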